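(* For any integers $n\geq 2$ and $p\geq 3$, the Sierpiński graph $S_p^n$ satisfies $$\gamma_{oitR}(S_p^n)=p\left\lceil\frac{p^{n-1}}{2}\right\rceil+(p-1)\left\lfloor\frac{p^{n-1}}{2}\right\rfloor.$$
   Context: For integers $n\geq 2$ and $p\geq 3$, the Sierpiński graph $S_p^n$ is the simple graph on the vertex set $\{0, 1,\ldots, p-1\}^n$, where two different vertices $(i_1,\ldots, i_n)$ and $(j_1, \ldots, j_n)$ are adjacent if and only if there exists an index $r\in\{1, \ldots, n\}$ such that (i) $i_t = j_t$ for $t=1,\ldots,r-1$; (ii) $i_r \neq j_r$; and (iii) $i_t = j_r$ and $j_t = i_r$ for $t=r+1,\ldots,n$. For a graph $G$ with no isolated vertex and a function $f:V(G)\to\{0,1,2\}$, let $V_i=\{v\in V(G): f(v)=i\}$ for $i\in\{0,1,2\}$. The function $f$ is an outer-independent total Roman dominating function on $G$ if (i) every vertex in $V_0$ is adjacent to at least one vertex in $V_2$; (ii) $V_0$ is an independent set; and (iii) the subgraph induced by $V_1\cup V_2$ has no isolated vertex. The outer-independent total Roman domination number $\gamma_{oitR}(G)$ is the minimum weight $\omega(f)=\sum_{v\in V(G)}f(v)$ among all such functions. *)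

(* Defs.v *)
From mathcomp Require Import all_boot.

Set Implicit Arguments.
Unset Strict Implicit.
Unset Printing Implicit Defensive.

(* Simple graphs are symmetric irreflexive relations on a finType. *)
Section OITRoman.
Variables (T : finType) (e : rel T).

Definition independent (A : {set T}) : bool :=
  [forall u in A, forall v in A, ~~ e u v].

(* The subgraph induced by A has no isolated vertex. *)
Definition no_isolated (A : {set T}) : bool :=
  [forall v in A, exists u in A, e v u].

Definition level (f : {ffun T -> 'I_3}) (i : nat) : {set T} :=
  [set v | f v == i :> nat].

Definition oitRDF (f : {ffun T -> 'I_3}) : bool :=
  [&& [forall v in level f 0, exists u in level f 2, e v u],
      independent (level f 0)
    & no_isolated (level f 1 :|: level f 2)].

Definition weight (f : {ffun T -> 'I_3}) : nat := \sum_v f v.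

(* The starting point of the minimisation, the constant function 1, is an
   outer-independent total Roman dominating function as soon as the graph has
   no isolated vertex; see gamma_oitRP. *)
Definition gamma_oitR : nat :=
  weight [arg min_(f < [ffun=> inord 1] | oitRDF f) weight f].

Lemma oitRDF_cst1 : no_isolated [set: T] -> oitRDF [ffun=> inord 1].
Proof.
move=> eT; have f1 v : ([ffun=> inord 1] : {ffun T -> 'I_3}) v = 1 :> nat.
  by rewrite ffunE inordK.
have lvl1 : level [ffun=> inord 1] 1 :|: level [ffun=> inord 1] 2 = setT.
  by apply/setP=> v; rewrite !inE f1.
rewrite /oitRDF lvl1 eT andbT; apply/andP; split.
  by apply/forallP=> v; rewrite inE f1.
by apply/forallP=> v; rewrite inE f1.
Qed.

Lemma gamma_oitRP : no_isolated [set: T] ->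
  (exists2 f, oitRDF f & weight f = gamma_oitR) /\
  (forall f, oitRDF f -> gamma_oitR <= weight f).
Proof.
move/oitRDF_cst1=> f1P; rewrite /gamma_oitR.
by case: arg_minnP => // f fP fmin; split; first by exists f.
Qed.

End OITRoman.

Definition sierpinski (p n : nat) : rel {ffun 'I_n -> 'I_p} :=
  fun x y => [exists r : 'I_n,
    [&& [forall t : 'I_n, (t < r) ==> (x t == y t)],
        x r != y r
      & [forall t : 'I_n, (r < t) ==> (x t == y r) && (y t == x r)]]].
Arguments sierpinski : clear implicits.

Lemma sierpinski_irrefl p n : irreflexive (sierpinski p n).
Proof. by move=> x; apply/existsP=> -[r /and3P[_ /eqP]]. Qed.

Lemma sierpinski_sym p n : symmetric (sierpinski p n).
Proof.
suff h x y : sierpinski p n x y -> sierpinski p n y x.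
  by move=> x y; apply/idP/idP; apply: h.
case/existsP=> r /and3P[/forallP h1 h2 /forallP h3].
apply/existsP; exists r; apply/and3P; split; last 1 first.
- by apply/forallP=> t; rewrite andbC; apply: h3.
- by apply/forallP=> t; rewrite eq_sym; apply: h1.
- by rewrite eq_sym.
Qed.

Lemma sierpinski_no_isolated p n :
  0 < n -> 1 < p -> no_isolated (sierpinski p n) [set: {ffun 'I_n -> 'I_p}].
Proof.
case: n => // n _; case: p => [|[|p]] // _.
apply/'forall_implyP => x _; pose a : 'I_p.+2 := if x ord_max == ord0 then ord_max else ord0.
have ax : x ord_max != a by rewrite /a; by case: (x ord_max =P ord0) => [->|/eqP].
apply/existsP; exists [ffun t => if t == ord_max then a else x t].
rewrite inE; apply/existsP; exists ord_max; rewrite ffunE eqxx ax /=.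
apply/andP; split; apply/forallP=> t; apply/implyP.
  by rewrite ffunE; case: (t =P ord_max) => // ->; rewrite ltnn.
by rewrite ltnNge -ltnS ltn_ord.
Qed.

(* Main.v *)
Require Import Defs.
From mathcomp Require Import all_boot all_algebra zify.

(* Write N = p ^ n.-1. The vertices of S_p^n split into N cliques [snoc u _] of
   order p, where u ranges over S_p^{n-1}. An independent set has at most one
   vertex in each clique, so a clique with k vertices of value 2 has weight at
   least p - 1 + k, and weight p - 1 is attained only if its zero is dominated
   from another clique. Counting these outside dominators, at most half of the
   cliques have weight p - 1.

   Equality comes from a matching of S_p^{n-1} missing at most one vertex: in a
   matched pair of cliques, the connecting edge gets the values 0 and 2, and the
   clique with the 2 gets one more zero. For p even, one matches the last letters.
   For p odd, u is read from the left by an automaton with state s, which moves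
   to 2s - a (mod p) on reading the letter a; if r is the last position at which
   the state changes, all later letters equal the new state k, so exchanging
   u_r and k from r on gives a neighbour of u, and this is an involution. *)

Set Implicit Arguments.
Unset Strict Implicit.
Unset Printing Implicit Defensive.

(** * Adjacency of words and the splitting into cliques *)

Lemma sierpinskiP p n (x y : {ffun 'I_n -> 'I_p}) :
  reflect (exists r : 'I_n, [/\ forall t : 'I_n, t < r -> x t = y t, x r != y r
             & forall t : 'I_n, r < t -> x t = y r /\ y t = x r])
          (sierpinski p n x y).
Proof.
apply: (iffP existsP) => -[r].
  case/and3P=> /forallP h1 h2 /forallP h3; exists r; split=> // t ht.
    by have /implyP/(_ ht)/eqP := h1 t.
  by have /implyP/(_ ht)/andP[/eqP -> /eqP ->] := h3 t.
case=> h1 h2 h3; exists r; apply/and3P; split=> //; apply/forallP=> t.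
  by apply/implyP=> /h1 ->.
by apply/implyP=> /h3[-> ->]; rewrite !eqxx.
Qed.

(* The letter that must be appended to [u] to obtain the endpoint of the unique
   edge between the cliques [snoc u _] and [snoc v _]; a junk value if u = v. *)
Definition port p m (u v : {ffun 'I_m.+1 -> 'I_p}) : 'I_p :=
  if [pick r | (u r != v r) && [forall t : 'I_m.+1, (t < r) ==> (u t == v t)]]
    is Some r then v r else v ord_max.

Lemma port_at p m (u v : {ffun 'I_m.+1 -> 'I_p}) (r : 'I_m.+1) :
  (forall t : 'I_m.+1, t < r -> u t = v t) -> u r != v r -> port u v = v r.
Proof.
move=> h1 h2; rewrite /port; case: pickP => [s /andP[s1 /forallP s2]|/(_ r)].
  case: (ltngtP s r) => [/h1 e|lt_rs|/val_inj -> //].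
    by rewrite e eqxx in s1.
  by have := s2 r; rewrite lt_rs (negbTE h2).
rewrite h2 /= => /negbT /forallPn[t]; rewrite negb_imply => /andP[/h1 ->].
by rewrite eqxx.
Qed.

(** If [u] and [u'] first differ from [v] at positions r < s, then [v s = u r], which is the common
    port [u' s], contradicting [v s != u' s]. So r = s, and the common letter at r determines the
    rest of the word. *)
Lemma sierpinski_port_inj p m (v u u' : {ffun 'I_m.+1 -> 'I_p}) :
  sierpinski p m.+1 v u -> sierpinski p m.+1 v u' ->
  port v u = port v u' -> u = u'.
Proof.
move=> /sierpinskiP[r [h1 h2 h3]] /sierpinskiP[s [k1 k2 k3]].
rewrite (port_at h1 h2) (port_at k1 k2) => e.
case: (ltngtP r s) => [lt|lt|/val_inj ers].
- by have [ev _] := h3 _ lt; rewrite ev e eqxx in k2.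
- by have [ev _] := k3 _ lt; rewrite ev e eqxx in h2.
subst s; apply/ffunP=> t; case: (ltngtP t r) => [lt|lt|/val_inj -> //].
  by rewrite -h1 ?k1.
by have [_ ->] := h3 _ lt; have [_ ->] := k3 _ lt.
Qed.

(** Past the first difference each word repeats the letter of the other, so the port can be read off
    the last letters. *)
Lemma port_last p m (u v : {ffun 'I_m.+1 -> 'I_p}) :
  sierpinski p m.+1 u v -> port u v = u ord_max \/ port u v = v ord_max.
Proof.
move=> /sierpinskiP[r [h1 h2 h3]]; rewrite (port_at h1 h2).
have [->|nr] := eqVneq r ord_max; [by right | left].
have lt: (r < @ord_max m)%N.
  by rewrite ltn_neqAle nr /= -ltnS ltn_ord.
by case: (h3 _ lt).
Qed.

Definition snoc p m (u : {ffun 'I_m -> 'I_p}) (a : 'I_p) :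
    {ffun 'I_m.+1 -> 'I_p} :=
  [ffun t => oapp u a (unlift ord_max t)].

Section Snoc.
Variables (p m : nat).
Implicit Types (u v : {ffun 'I_m -> 'I_p}) (a b : 'I_p).

Lemma snoc_max u a : snoc u a ord_max = a.
Proof. by rewrite ffunE unlift_none. Qed.

Lemma snoc_lift u a t : snoc u a (lift ord_max t) = u t.
Proof. by rewrite ffunE liftK. Qed.

Lemma snocP (x : {ffun 'I_m.+1 -> 'I_p}) : exists u a, x = snoc u a.
Proof.
exists [ffun t => x (lift ord_max t)], (x ord_max); apply/ffunP=> t.
by rewrite !ffunE; case: unliftP => [j ->|-> //] /=; rewrite ffunE.
Qed.

Lemma snoc_inj u v a b : snoc u a = snoc v b -> u = v /\ a = b.
Proof.
move=> /ffunP e; split; last by have := e ord_max; rewrite !snoc_max.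
by apply/ffunP=> t; have := e (lift ord_max t); rewrite !snoc_lift.
Qed.

Lemma sum_snoc (F : {ffun 'I_m.+1 -> 'I_p} -> nat) :
  \sum_x F x = \sum_u \sum_a F (snoc u a).
Proof.
rewrite pair_big /=.
rewrite (reindex (fun q : {ffun 'I_m -> 'I_p} * 'I_p => snoc q.1 q.2)) //=.
exists (fun x : {ffun 'I_m.+1 -> 'I_p} =>
          ([ffun t => x (lift ord_max t)], x ord_max)) => [[u a] _ | x _] /=.
  by rewrite snoc_max; congr pair; apply/ffunP=> t; rewrite ffunE snoc_lift.
have [u [a ->]] := snocP x; rewrite snoc_max; congr snoc.
by apply/ffunP=> t; rewrite ffunE snoc_lift.
Qed.

Lemma sierpinski_snoc u a b : a != b -> sierpinski p m.+1 (snoc u a) (snoc u b).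
Proof.
move=> nab; apply/sierpinskiP; exists ord_max; split.
- move=> t; case: (unliftP ord_max t) => [j ->|->]; last by rewrite ltnn.
  by rewrite !snoc_lift.
- by rewrite !snoc_max.
- by move=> t; rewrite ltnNge -ltnS ltn_ord.
Qed.

End Snoc.

Lemma sierpinski_snoc_port p m (u v : {ffun 'I_m.+1 -> 'I_p}) :
  sierpinski p m.+1 u v ->
  sierpinski p m.+2 (snoc u (port u v)) (snoc v (port v u)).
Proof.
move=> /sierpinskiP[r [h1 h2 h3]].
have h1' (t : 'I_m.+1) : t < r -> v t = u t by move=> /h1.
rewrite (port_at h1 h2) (port_at h1') 1?eq_sym //.
apply/sierpinskiP; exists (lift ord_max r); rewrite !snoc_lift lift_max; split=> // t.
  case: (unliftP ord_max t) => [j ->|-> /=].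
    by rewrite lift_max !snoc_lift; apply: h1.
  by move=> lt; have := ltn_ord r; lia.
case: (unliftP ord_max t) => [j ->|-> /= _]; last by rewrite !snoc_max.
by rewrite lift_max !snoc_lift; apply: h3.
Qed.

Lemma sierpinski_snoc_inv p m (u v : {ffun 'I_m.+1 -> 'I_p}) a b :
  sierpinski p m.+2 (snoc u a) (snoc v b) -> u != v ->
  [/\ sierpinski p m.+1 u v, a = port u v & b = port v u].
Proof.
move=> /sierpinskiP[r]; case: (unliftP ord_max r) => [j ->|->].
  rewrite !snoc_lift lift_max => -[h1 h2 h3] _.
  have k1 (t : 'I_m.+1) : t < j -> u t = v t.
    by have := h1 (lift ord_max t); rewrite lift_max !snoc_lift.
  have k1' (t : 'I_m.+1) : t < j -> v t = u t by move=> /k1.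
  rewrite (port_at k1 h2) (port_at k1') 1?eq_sym //.
  split; last 2 first.
  - by have := h3 ord_max (ltn_ord j); rewrite !snoc_max => -[].
  - by have := h3 ord_max (ltn_ord j); rewrite !snoc_max => -[].
  apply/sierpinskiP; exists j; split=> // t lt.
  by have := h3 (lift ord_max t); rewrite lift_max !snoc_lift; apply.
case=> h1 _ _ /eqP[]; apply/ffunP=> t.
have := h1 (lift ord_max t); rewrite lift_max !snoc_lift; apply.
exact: ltn_ord.
Qed.

Lemma sum_nat_of_pred (T : finType) (P : pred T) : \sum_x P x = #|P|.
Proof.
by rewrite -sum1_card [RHS]big_mkcond; apply: eq_bigr => x _; rewrite unfold_in; case: (P x).
Qed.

(** * Lower bound by counting clique weights *)

Section LowerBound.
Variables (p m : nat) (f : {ffun {ffun 'I_m.+2 -> 'I_p} -> 'I_3}).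
Hypothesis fP : oitRDF (sierpinski p m.+2) f.
Implicit Types (u v : {ffun 'I_m.+1 -> 'I_p}) (a b : 'I_p).

Let zeros u := \sum_a (f (snoc u a) == 0 :> nat).
Let twos u := \sum_a (f (snoc u a) == 2 :> nat).
Let bad u := [exists a, f (snoc u a) == 0 :> nat] && (twos u == 0).

Let clique_weight u : \sum_a f (snoc u a) + zeros u = p + twos u.
Proof.
rewrite -big_split /= -[X in X + _](card_ord p) -sum1_card -big_split /=.
by apply: eq_bigr => a _; case: (f (snoc u a)) => -[|[|[|]]].
Qed.

Let zero_uniq u a b :
  f (snoc u a) = 0 :> nat -> f (snoc u b) = 0 :> nat -> a = b.
Proof.
move=> fa fb; apply/eqP; apply: contraT => nab.
case/and3P: fP => _ /forall_inP ind _.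
have /ind/forall_inP/(_ (snoc u b)) : snoc u a \in level f 0 by rewrite inE fa.
by rewrite inE fb sierpinski_snoc //; apply.
Qed.

Let zerosE u : zeros u = [exists a, f (snoc u a) == 0 :> nat].
Proof.
case: existsP => [[a fa]|no0]; rewrite /zeros.
  rewrite (bigD1 a) //= fa big1 // => b nba; apply/eqP; rewrite eqb0.
  by apply: contra nba => fb; apply/eqP/(@zero_uniq u); apply/eqP.
by rewrite big1 // => a _; apply/eqP; rewrite eqb0; apply/negP => fa; case: no0; exists a.
Qed.

(* Distinct bad cliques have their zero dominated from outside by distinct
   vertices of value 2, as a vertex has at most one neighbour outside its
   clique. *)
Let card_bad : \sum_u bad u <= \sum_u twos u.
Proof.
have /fin_all_exists[g gP] u : exists y, bad u -> f y = 2 :> nat /\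
    exists a v b, [/\ y = snoc v b, u != v & sierpinski p m.+2 (snoc u a) y].
  case bu: (bad u); last by exists (snoc u (u ord_max)).
  case/andP: bu => /existsP[a fa] /eqP no2; case/and3P: fP => /forall_inP h _ _.
  have /h/exists_inP[y] : snoc u a \in level f 0 by rewrite inE.
  rewrite inE => /eqP fy ay; exists y => _; split=> //.
  have [v [b ey]] := snocP y; exists a, v, b; split=> //.
  apply/eqP=> euv; move/eqP: no2; rewrite /twos sum_nat_eq0 => /forall_inP/(_ b isT).
  by rewrite euv -ey fy.
have g_inj : {in bad &, injective g}.
  move=> u u' /gP[_ [a [v [b [eg nuv adj]]]]] /gP[_ [a' [v' [b' [eg' nuv' adj']]]]] eguu.
  have [ev eb] : v = v' /\ b = b' by apply: snoc_inj; rewrite -eg -eg'.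
  subst v' b'; rewrite eg in adj; rewrite eg' in adj'.
  have [s1 _ e1] := sierpinski_snoc_inv adj nuv.
  have [s2 _ e2] := sierpinski_snoc_inv adj' nuv'.
  by apply: (@sierpinski_port_inj _ _ v); rewrite 1?sierpinski_sym // -e1 -e2.
rewrite -(sum_snoc (fun y => (f y == 2 :> nat) : nat)) !sum_nat_of_pred.
rewrite -(card_in_imset g_inj); apply/subset_leq_card/subsetP=> y.
by case/imsetP=> u /gP[fg _] ->; apply/eqP.
Qed.

(** Let N, T, B count the cliques, the values 2 and the bad cliques, and let w be the weight. Then
    pN + T <= w + N and pN <= w + B; adding these and using B <= T gives 2pN <= 2w + N. *)
Lemma weight_lower_bound :
  p * p ^ m.+1 <= weight f + (p ^ m.+1)./2.
Proof.
have Ew : weight f = \sum_u \sum_a f (snoc u a) by apply: sum_snoc.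
have N : p ^ m.+1 = \sum_(u : {ffun 'I_m.+1 -> 'I_p}) 1.
  by rewrite sum1_card card_ffun !card_ord.
have c1 u : 1 * p + twos u <= \sum_a f (snoc u a) + 1.
  by have := clique_weight u; have := zerosE u; case: existsP => _; lia.
have c2 u : 1 * p <= \sum_a f (snoc u a) + bad u.
  have := clique_weight u; have := zerosE u; rewrite /bad.
  by case: existsP => _; case: eqP => /=; lia.
have le1 : p * p ^ m.+1 + \sum_u twos u <= weight f + p ^ m.+1.
  by rewrite Ew N mulnC big_distrl -!big_split; apply: leq_sum => u _; apply: c1.
have le2 : p * p ^ m.+1 <= weight f + \sum_u bad u.
  by rewrite Ew {1}N mulnC big_distrl -big_split; apply: leq_sum => u _; apply: c2.
by have := card_bad; lia.
Qed.

End LowerBound.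

(** * A matching of words defined by an automaton *)

Section Automaton.
Variables (p m : nat) (sigma : 'I_p -> 'I_p -> 'I_p) (s0 : 'I_p).
Hypothesis sigmaK : forall s, involutive (sigma s).
Hypothesis sigma_fix : forall s a, (sigma s a == a) = (a == s).
Implicit Types u v : {ffun 'I_m.+1 -> 'I_p}.

Fixpoint state u (k : nat) : 'I_p :=
  if k is k'.+1 then sigma (state u k') (u (inord k')) else s0.

Definition turn u (r : 'I_m.+1) :=
  (u r != state u r) && [forall t : 'I_m.+1, (r < t) ==> (u t == state u t)].

Definition swap u :=
  if [pick r | turn u r] is Some r then
    [ffun t : 'I_m.+1 => if t < r then u t
                         else if t == r then sigma (state u r) (u r) else u r]
  else u.

Lemma sigma_id s : sigma s s = s.
Proof. by apply/eqP; rewrite sigma_fix. Qed.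

Lemma turn_uniq u r s : turn u r -> turn u s -> r = s.
Proof.
move=> /andP[ur /forallP hr] /andP[us /forallP hs].
case: (ltngtP r s) => [lt|lt|/val_inj //].
  by have := hr s; rewrite lt (negbTE us).
by have := hs r; rewrite lt (negbTE ur).
Qed.

Lemma swapE u r : turn u r ->
  [/\ forall t : 'I_m.+1, t < r -> swap u t = u t,
      swap u r = sigma (state u r) (u r)
    & forall t : 'I_m.+1, r < t -> swap u t = u r].
Proof.
rewrite /swap => tr; case: pickP => [s ts|/(_ r)]; last by rewrite tr.
rewrite (turn_uniq ts tr); split=> [t lt||t lt]; rewrite ffunE ?lt ?ltnn ?eqxx //.
by rewrite ltnNge ltnW //= -val_eqE /= gtn_eqF.
Qed.

Lemma eq_state u v (r : 'I_m.+1) :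
  (forall t : 'I_m.+1, t < r -> u t = v t) -> state u r = state v r.
Proof.
move=> h; have: r <= r by []; elim: {1 3 4}(r : nat) => //= k IH lt.
by rewrite IH ?(ltnW lt) // h // inordK // (ltn_trans lt).
Qed.

(** Reading the current state leaves it unchanged. The disjunction serves both [swap u], whose later
    letters are known to be [a], and [u], whose later letters are known to equal the state. *)
Lemma state_const u a (r : 'I_m.+1) :
  state u r.+1 = a -> (forall t : 'I_m.+1, r < t -> u t = a \/ u t = state u t) ->
  forall t : 'I_m.+1, r < t -> state u t = a.
Proof.
move=> ea h t; move: (ltn_ord t); elim: (t : nat) => // k IH ltk.
rewrite ltnS leq_eqVlt => /predU1P[<- //|lt]; have ltk' := ltnW ltk.
have ek := IH ltk' lt; have := h (inord k); rewrite inordK // ek /= ek.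
by move=> /(_ lt)[] ->; rewrite sigma_id.
Qed.

Lemma state_swap u r : turn u r -> state (swap u) r = state u r.
Proof. by case/swapE=> h _ _; apply: eq_state. Qed.

(** With s the state at r, the new word reads [sigma s (u r)] there and so moves to [u r], which is
    also each of its later letters: the last change of state is again at r. *)
Lemma turn_swap u r : turn u r -> turn (swap u) r.
Proof.
move=> tr; have [h1 h2 h3] := swapE tr; apply/andP; split.
  (* Writing s as [sigma s s] reduces the goal to [u r != s] by injectivity. *)
  rewrite h2 state_swap // -{2}[state u r](sigmaK (state u r)) sigma_id.
  rewrite (inj_eq (inv_inj (sigmaK _))).
  by case/andP: tr.
apply/forallP=> t; apply/implyP=> lt; rewrite h3 //.
rewrite (@state_const _ (u r) r) //; last by move=> s /h3; left.
by rewrite /= inord_val state_swap // h2 sigmaK.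
Qed.

Lemma swapK : involutive swap.
Proof.
move=> u; case: (pickP (turn u)) => [r tr|no]; last first.
  have e: swap u = u by rewrite /swap; case: pickP => // r; rewrite no.
  by rewrite !e.
have [h1 h2 h3] := swapE tr; have [k1 k2 k3] := swapE (turn_swap tr).
apply/ffunP=> t; case: (ltngtP t r) => [lt|lt|/val_inj ->].
- by rewrite k1 ?h1.
- rewrite k3 // h2; case/andP: tr => _ /forallP h.
  have ht (s : 'I_m.+1) : r < s -> u s = state u s.
    by move=> lts; have := h s; rewrite lts => /eqP.
  rewrite [u t]ht //; apply/esym/(@state_const u _ r) => //=.
    by rewrite inord_val.
  by move=> s /ht; right.
- by rewrite k2 state_swap // h2 sigmaK.
Qed.

Lemma swap_adj u : swap u = u \/ sierpinski p m.+1 u (swap u).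
Proof.
case: (pickP (turn u)) => [r tr|no]; last first.
  by left; rewrite /swap; case: pickP => // r; rewrite no.
right; have [h1 h2 h3] := swapE tr; apply/sierpinskiP; exists r; split.
- by move=> t /h1.
- by rewrite h2 eq_sym sigma_fix; case/andP: tr.
move=> t lt; split; last exact: h3.
(* The old letters after r are obtained as the new letters of the second swap. *)
by have [_ _ k3] := swapE (turn_swap tr); rewrite -(k3 _ lt) swapK.
Qed.

(** A turn would change the letter at r, so a fixed word has none, and the state remains [s0]
    throughout. *)
Lemma swap_fix u : swap u = u -> u = [ffun => s0].
Proof.
move=> fu.
have no r : ~~ turn u r.
  apply/negP=> tr; have [_ + _] := swapE tr; rewrite fu => /esym/eqP.
  by rewrite sigma_fix; case/andP: tr => /negbTE ->.
have ut t : u t = state u t.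
  apply/eqP; apply: contraT => ht.
  (* The last position whose letter differs from the state would be a turn. *)
  case: (@arg_maxnP _ t (fun t => u t != state u t) val ht) => r hr rmax.
  case/negP: (no r); apply/andP; split=> //; apply/forallP=> s; apply/implyP.
  by rewrite ltnNge; apply: contraR => /rmax.
have st k : k < m.+1 -> state u k = s0.
  elim: k => //= k IH lt; have lt' := ltnW lt.
  by rewrite ut inordK // IH // sigma_id.
by apply/ffunP=> t; rewrite ffunE ut st.
Qed.

End Automaton.

(** * Point reflections modulo an odd number *)

Section PointReflection.
Variable k : nat.
Import GRing.Theory.
Local Open Scope ring_scope.
Implicit Types s a : 'I_k.*2.+1.

Definition reflect_in s a : 'I_k.*2.+1 := s *+ 2 - a.

Lemma reflect_inK s : involutive (reflect_in s).
Proof. by move=> a; rewrite /reflect_in opprB addrCA subrr addr0. Qed.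

Lemma reflect_in_fix s a : (reflect_in s a == a) = (a == s).
Proof.
(* Doubling is injective modulo 2k + 1: if 2x = 0, then x = (2k + 1)x - k(2x) = 0. *)
have mul2_eq0 (x : 'I_k.*2.+1) : (x *+ 2 == 0) = (x == 0).
  apply/eqP/eqP=> [x2|->]; last by rewrite mul0rn.
  have: x *+ k.*2.+1 = 0 by rewrite Zp_mulrn; apply/val_inj; rewrite /= modnMl.
  have kx : x *+ k.*2 = 0 by have := mulrnA x 2 k; rewrite mul2n x2 mul0rn.
  by rewrite mulrS kx addr0.
by rewrite -subr_eq0 /reflect_in -addrA -opprD -mulr2n -mulrnBl mul2_eq0 subr_eq0 eq_sym.
Qed.

End PointReflection.

(** * The matching for either parity of p *)

Lemma sierpinski_near_perfect_matching p m :
  exists M : {ffun 'I_m.+1 -> 'I_p} -> {ffun 'I_m.+1 -> 'I_p},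
    [/\ involutive M, forall u, M u = u \/ sierpinski p m.+1 u (M u)
      & forall u v, M u = u -> M v = v -> u = v].
Proof.
case: (boolP (odd p)) => [podd|peven].
  have -> : p = p./2.*2.+1 by rewrite -{1}(odd_double_half p) podd.
  exists (swap (@reflect_in p./2) ord0); split.
  - exact: swapK (@reflect_inK _) (@reflect_in_fix _).
  - exact: swap_adj (@reflect_inK _) (@reflect_in_fix _).
  - move=> u v hu hv.
    by rewrite (swap_fix (@reflect_in_fix _) hu) (swap_fix (@reflect_in_fix _) hv).
(* For p even, a -> p - 1 - a fixes no letter, so the matching is perfect. *)
pose M (u : {ffun 'I_m.+1 -> 'I_p}) : {ffun 'I_m.+1 -> 'I_p} :=
  [ffun t => if t == ord_max then rev_ord (u t) else u t].
have rev_neq (a : 'I_p) : rev_ord a != a.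
  by apply/eqP=> /(congr1 val) /=; have := ltn_ord a; lia.
exists M; split=> [u|u|u v /ffunP/(_ ord_max)].
- by apply/ffunP=> t; rewrite !ffunE; case: eqP => // _; rewrite rev_ordK.
- right; apply/sierpinskiP; exists ord_max; split=> [t lt||t].
  + by rewrite ffunE -val_eqE /= ltn_eqF.
  + by rewrite ffunE eqxx eq_sym.
  + by rewrite ltnNge -ltnS ltn_ord.
- by rewrite ffunE eqxx => /eqP; rewrite (negbTE (rev_neq _)).
Qed.

(** * Orienting the pairs of letters *)

Section CyclicSuccessor.
Variable p : nat.
Hypothesis p_gt2 : 2 < p.

Lemma val_ordS (c : 'I_p) :
  ordS c = (if c.+1 == p then 0 else c.+1) :> nat.
Proof.
have := ltn_ord c; rewrite /= leq_eqVlt; case: eqP => [->|_ /=] ; first by rewrite modnn.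
exact: modn_small.
Qed.

Lemma ordS_neq (c : 'I_p) : ordS c != c.
Proof.
apply/eqP=> /(congr1 (@nat_of_ord p)); rewrite val_ordS.
by have := ltn_ord c; case: eqP; lia.
Qed.

Lemma ordS2_neq (c : 'I_p) : ordS (ordS c) != c.
Proof.
apply/eqP=> /(congr1 (@nat_of_ord p)); rewrite !val_ordS.
by have := ltn_ord c; do 2 case: eqP; lia.
Qed.

(* An orientation of the pairs of letters that contains every arc from [c] to
   its cyclic successor. *)
Definition prec (c d : 'I_p) := (d == ordS c) || (c != ordS d) && (c < d).

(** As p > 2, the arcs c to d and d to c are not both successor arcs; pairs without a successor arc
    follow the numerical order. *)
Lemma prec_anti c d : c != d -> prec d c = ~~ prec c d.
Proof.
move=> ncd; have ncd' : c != d :> nat by [].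
rewrite /prec; case: (eqVneq d (ordS c)) => [->|_] /=.
  by rewrite eq_sym (negbTE (ordS2_neq c)).
by case: eqP => //= _; rewrite ltn_neqAle eq_sym ncd' /= leqNgt.
Qed.

End CyclicSuccessor.

(** This allows [prec] to orient every matched pair by its last letters. *)
Lemma sierpinski_last_neq p m (u v : {ffun 'I_m.+1 -> 'I_p}) :
  sierpinski p m.+1 u v -> u ord_max != v ord_max.
Proof.
move=> /sierpinskiP[r [_ h2 h3]].
have [<- //|nr] := eqVneq r ord_max.
have lt: (r < @ord_max m)%N by rewrite ltn_neqAle nr /= -ltnS ltn_ord.
by have [-> ->] := h3 _ lt; rewrite eq_sym.
Qed.

(** * Upper bound: the function built from a matching *)

Section UpperBound.
Variables (p m : nat) (M : {ffun 'I_m.+1 -> 'I_p} -> {ffun 'I_m.+1 -> 'I_p}).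
Hypotheses (p_gt2 : 2 < p) (MK : involutive M).
Hypothesis M_adj : forall u, M u = u \/ sierpinski p m.+1 u (M u).
Hypothesis M_fix : forall u v, M u = u -> M v = v -> u = v.
Implicit Types (u v : {ffun 'I_m.+1 -> 'I_p}) (a b : 'I_p).

Let light u := (M u != u) && prec (u ord_max) (M u ord_max).
Let heavy u := (M u != u) && ~~ prec (u ord_max) (M u ord_max).

(* The clique weights are p - 1 if [light], and p otherwise. The zero of a
   light clique is dominated by the 2 of its partner; the zero of a heavy
   clique sits at the cyclic successor of its last letter, which prevents two
   such zeros from being adjacent. *)
Let val_at u a : nat :=
  if M u == u then 1
  else if a == port u (M u) then (if light u then 0 else 2)
  else if heavy u && (a == ordS (u ord_max)) then 0 else 1.

Definition matching_oitRDF : {ffun {ffun 'I_m.+2 -> 'I_p} -> 'I_3} :=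
  [ffun x : {ffun 'I_m.+2 -> 'I_p} =>
     inord (val_at [ffun t => x (lift ord_max t)] (x ord_max))].
Let f := matching_oitRDF.

Let fE u a : f (snoc u a) = val_at u a :> nat.
Proof.
rewrite ffunE snoc_max.
have -> : [ffun t => snoc u a (lift ord_max t)] = u.
  by apply/ffunP=> t; rewrite ffunE snoc_lift.
by rewrite inordK // /val_at; do 4?case: ifP.
Qed.

Let light_neqP u : M u != u -> sierpinski p m.+1 u (M u).
Proof. by case: (M_adj u) => [->|//]; rewrite eqxx. Qed.

Let heavyE u : heavy u = light (M u).
Proof.
rewrite /heavy /light MK [u == _]eq_sym; case: eqP => //= /eqP nM.
by rewrite -prec_anti // sierpinski_last_neq // light_neqP.
Qed.

Let heavyN u : M u != u -> heavy u = ~~ light u.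
Proof. by rewrite /heavy /light => ->. Qed.

(** The port is the last letter of [u] or of its partner; the latter is not the successor of the
    former, since [prec] contains all successor arcs. So the zero and the 2 do not collide. *)
Let heavy_port u : heavy u -> ordS (u ord_max) != port u (M u).
Proof.
case/andP=> nM npr; rewrite eq_sym; have [->|->] := port_last (light_neqP nM).
  by rewrite eq_sym ordS_neq.
by apply: contra npr => /eqP ->; rewrite /prec eqxx.
Qed.

Let zeroP u a : val_at u a = 0 ->
  light u /\ a = port u (M u) \/ heavy u /\ a = ordS (u ord_max).
Proof.
rewrite /val_at; case: eqP => // _; case: (a =P port u _) => [->|_].
  by case: ifP => // lu _; left.
by case: andP => // -[hu /eqP ->] _; right.
Qed.

Let zero_uniq u a b : val_at u a = 0 -> val_at u b = 0 -> a = b.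
Proof.
by move=> /zeroP[[l ->]|[l ->]] /zeroP[[l' ->]|[l' ->]] //; move: l l';
  rewrite /light /heavy => /andP[_ h] /andP[_]; rewrite ?h // (negbTE h).
Qed.

Let two_at u : heavy u -> val_at u (port u (M u)) = 2.
Proof.
by move=> hu; have /andP[nM h] := hu; rewrite /val_at (negbTE nM) eqxx /light nM (negbTE h).
Qed.

Let two_at_partner u : light u -> val_at (M u) (port (M u) u) = 2.
Proof. by move=> lu; have := @two_at (M u); rewrite heavyE !MK; apply. Qed.

Let light_port u v :
  light u -> sierpinski p m.+1 u v -> port u v = port u (M u) -> v = M u.
Proof. by case/andP=> /light_neqP h _ s; apply: sierpinski_port_inj. Qed.

Lemma matching_oitRDFP : oitRDF (sierpinski p m.+2) f.
Proof.
apply/and3P; split.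
- apply/forall_inP=> x; have [u [a ->]] := snocP x.
  rewrite inE fE => /eqP/zeroP[[lu ->]|[hu ->]].
    have nM : M u != u by case/andP: lu.
    apply/exists_inP; exists (snoc (M u) (port (M u) u)).
      by rewrite inE fE two_at_partner.
    exact/sierpinski_snoc_port/light_neqP.
  apply/exists_inP; exists (snoc u (port u (M u))); first by rewrite inE fE two_at.
  exact/sierpinski_snoc/heavy_port.
- apply/forall_inP=> x; have [u [a ->]] := snocP x; rewrite inE fE => /eqP xa.
  apply/forall_inP=> y; have [v [b ->]] := snocP y; rewrite inE fE => /eqP yb.
  apply/negP=> adj; have [euv|nuv] := eqVneq u v.
    subst v; move: adj; rewrite (zero_uniq xa yb).
    by rewrite sierpinski_irrefl.
  have [suv ea eb] := sierpinski_snoc_inv adj nuv.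
  have svu : sierpinski p m.+1 v u by rewrite sierpinski_sym.
  (* The only outside neighbour of the zero of a light clique is the 2 of its partner. *)
  case: (zeroP xa) => -[hu ea'].
    have ev : v = M u by apply: light_port; rewrite // -ea.
    by move: yb; rewrite eb ev two_at_partner.
  case: (zeroP yb) => -[hv eb'].
    have eu : u = M v by apply: light_port; rewrite // -eb.
    by move: xa; rewrite ea eu two_at_partner.
  (* Two adjacent heavy zeros would each sit at the last letter of the other clique, making these
     two letters successors of each other. *)
  have e1 : ordS (u ord_max) = v ord_max.
    rewrite -ea' ea; case: (port_last suv) => // e.
    by move: (ordS_neq p_gt2 (u ord_max)); rewrite -ea' ea e eqxx.
  have e2 : ordS (v ord_max) = u ord_max.
    rewrite -eb' eb; case: (port_last svu) => // e.
    by move: (ordS_neq p_gt2 (v ord_max)); rewrite -eb' eb e eqxx.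
  by move: (ordS2_neq p_gt2 (u ord_max)); rewrite e1 e2 eqxx.
have nzE x : (x \in level f 1 :|: level f 2) = (f x != 0 :> nat).
  by rewrite !inE; case: (f x) => -[|[|[|]]].
apply/forall_inP=> x _; have [u [a ->]] := snocP x.
(* The next two letters after [a] are distinct and differ from [a]; at most one of them carries the
   zero of the clique. *)
have n1 := ordS_neq p_gt2 a; have n2 := ordS2_neq p_gt2 a.
have n12 := ordS_neq p_gt2 (ordS a).
have [z1|z1] := eqVneq (val_at u (ordS a)) 0; last first.
  apply/exists_inP; exists (snoc u (ordS a)); first by rewrite nzE fE.
  by rewrite sierpinski_snoc // eq_sym.
apply/exists_inP; exists (snoc u (ordS (ordS a))); last first.
  by rewrite sierpinski_snoc // eq_sym.
rewrite nzE fE; apply: contra n12 => /eqP z2.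
exact/eqP/esym/(zero_uniq z1 z2).
Qed.

Lemma weight_matching_oitRDF : weight f + (p ^ m.+1)./2 = p * p ^ m.+1.
Proof.
have N : p ^ m.+1 = \sum_(u : {ffun 'I_m.+1 -> 'I_p}) 1.
  by rewrite sum1_card card_ffun !card_ord.
have clique u : \sum_a f (snoc u a) + light u = p.
  have sum_eq z : \sum_(a : 'I_p) (a == z) = 1 by rewrite sum_nat_of_pred card1.
  have sum1 : \sum_(a : 'I_p) 1 = p by rewrite sum1_card card_ord.
  have [eM|nM] := eqVneq (M u) u.
    rewrite /light eM eqxx /= addn0 -[RHS]sum1; apply: eq_bigr => a _.
    by rewrite fE /val_at eM eqxx.
  have [lu|hu] := boolP (light u).
    have : \sum_a (f (snoc u a) + (a == port u (M u))) = p.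
      rewrite -[RHS]sum1; apply: eq_bigr => a _.
      by rewrite fE /val_at (negbTE nM) heavyN // lu /=; case: eqP.
    by rewrite big_split sum_eq.
  have hu' : heavy u by rewrite heavyN.
  (* Filling in the zero leaves all values 1, with an extra 1 at the port. *)
  have : \sum_a (f (snoc u a) + (a == ordS (u ord_max))) =
         \sum_a (1 + (a == port u (M u))).
    apply: eq_bigr => a _; rewrite fE /val_at (negbTE nM) hu' (negbTE hu) /=.
    case: (a =P port u _) => [->|_]; last by case: eqP.
    by rewrite eq_sym (negbTE (heavy_port hu')).
  by rewrite !big_split !sum_eq sum1 addn0 => /addIn.
have wE : weight f + \sum_u light u = p * p ^ m.+1.
  rewrite /weight sum_snoc -big_split /= N mulnC big_distrl /=.
  by apply: eq_bigr => u _; rewrite clique mul1n.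
have Elh : \sum_u light u = \sum_u heavy u.
  rewrite (reindex_inj (inv_inj MK)) /=.
  by apply: eq_bigr => u _; rewrite heavyE.
have fix1 : \sum_u (M u == u) <= 1.
  rewrite sum_nat_of_pred; apply/card_le1P => u + v; rewrite !inE => /eqP hu.
  by apply/eqP/eqP=> [hv|->//]; apply: M_fix.
(* Light and heavy cliques are equinumerous and at most one is unmatched, so exactly [(p ^ m.+1)./2]
   are light. *)
have : p ^ m.+1 = \sum_u light u + \sum_u heavy u + \sum_u (M u == u).
  rewrite N -!big_split; apply: eq_bigr => u _ /=; rewrite /light /heavy.
  by case: eqP => //= _; case: prec.
by lia.
Qed.

End UpperBound.

Theorem theorem3p1 (n p : nat) (hn : 2 <= n) (hp : 3 <= p) :
  gamma_oitR (sierpinski p n) =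
    p * uphalf (p ^ n.-1) + (p - 1) * (p ^ n.-1)./2.
Proof.
case: n hn => [|[|m]] // _.
have [[f fP <-] fmin] :=
  gamma_oitRP (@sierpinski_no_isolated p m.+2 isT (ltnW hp)).
have [M [MK M_adj M_fix]] := sierpinski_near_perfect_matching p m.
have := fmin _ (matching_oitRDFP hp MK M_adj).
have := weight_matching_oitRDF hp MK M_adj M_fix.
have := weight_lower_bound fP.
(* Both bounds equal pN - h, where N = o + 2h and o is the parity of N; this is p(o + h) + (p -
   1)h. *)
rewrite /= uphalf_half; have := odd_double_half (p ^ m.+1).
move: (weight _) (weight _) (p ^ m.+1) => w w' N; move: (odd N : nat) N./2 => o h.
by nia.
Qed.
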